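(* Let $d\ge 1$ be a fixed integer. The sequence $\big(H^{(d)}_n(q)\big)_{n\ge 0}$ of $d$-Hoggatt polynomials is strongly $q$-log-convex; that is, for all integers $n\ge m\ge 1$, the polynomial $$H^{(d)}_{n+1}(q)H^{(d)}_{m-1}(q)-H^{(d)}_n(q)H^{(d)}_m(q)$$ has only nonnegative coefficients.
   Context: For integers $n,k\ge 0$ the $d$-Hoggatt numbers are $$\left\langle {n\atop k}\right\rangle^{(d)}:=\prod_{j=0}^{d-1}\frac{\binom{n+j}{k}}{\binom{k+j}{k}},$$ and the $d$-Hoggatt polynomials, in the indeterminate $q$, are $$H_n^{(d)}(q):=\sum_{k=0}^n\left\langle {n\atop k}\right\rangle^{(d)}q^k .$$ For $f,g\in\mathbb{R}[q]$ write $f\ge_q g$ if $f-g\in\mathbb{R}_{\ge 0}[q]$. A sequence $(a_n(q))_{n\ge 0}$ of polynomials over $\mathbb{R}$ is strongly $q$-log-convex if $a_{n+1}(q)a_{m-1}(q)\ge_q a_n(q)a_m(q)$ for all $n\ge m\ge 1$. *)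

(* Defs.v *)
From mathcomp Require Import all_boot all_order all_algebra.
Set Implicit Arguments.
Unset Strict Implicit.
Unset Printing Implicit Defensive.
Import Order.TTheory GRing.Theory Num.Theory.
Local Open Scope ring_scope.

(* The value is a rational number, embedded in R so that it can serve as a
   coefficient; each denominator 'C(k + j, k) is nonzero. *)
Definition hoggatt_number (R : numFieldType) (d n k : nat) : R :=
  \prod_(j < d) ('C(n + j, k)%:R / 'C(k + j, k)%:R).

Definition hoggatt_poly (R : numFieldType) (d n : nat) : {poly R} :=
  \sum_(k < n.+1) hoggatt_number R d n k *: 'X^k.

Definition qge (R : numFieldType) (f g : {poly R}) : Prop :=
  f - g \is a polyOver Num.nneg.

Definition strongly_q_log_convex (R : numFieldType) (a : nat -> {poly R}) : Prop :=
  forall n m : nat, (1 <= m <= n)%N -> qge (a n.+1 * a m.-1) (a n * a m).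

(* Main.v *)
Require Import Defs.
From mathcomp Require Import all_boot all_order all_algebra.
From mathcomp Require Import reals.
From mathcomp Require Import perm.
From mathcomp Require Import zify ring.

(** Let d particles start at the sites 0, ..., d-1 and let each of them, at every
    unit of time, stay or advance by one, two particles never sharing a site.
    The number of ways in which they occupy k, ..., k+d-1 at time n is the
    Hoggatt number of n and k ([families_formula], [family_formula_packed]).
    Hence the coefficient of q^t in H_n H_m counts pairs (F, G) of such families,
    of lengths n and m, with packed final positions k + {0, ..., d-1} and
    t-k + {0, ..., d-1}, where k is free.  The theorem says that there are at
    least as many pairs of lengths n+1, m as of lengths n, m+1 when m <= n
    ([packed_pairs_le]).

    Peeling off the last step of the longer family on each side leaves, for each
    set A of advancing particles, two families of lengths n and m, one of which
    ends packed and the other at a packed configuration minus the indicator of A.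
    Unless particles collide in it, that second configuration has gaps at least
    as wide as the packed one, so the claim becomes: the wider end prefers the
    longer family ([swap_ends_le]).  Cutting the first n-m steps off the longer
    family F turns length into width: both families now run for m steps, but F
    starts from gaps at least as wide as those of G.

    So let F and G run for the same time, F starting wider.  Fix the sum
    s = F + G of the final positions.  The number of pairs is then a function of
    F alone, and the heart of the proof ([lipschitz_sum_families]) is that it is
    a sum of indicators of systems of inequalities h_p - h_q <= C p q, where p
    and q range over 2d boundary points: the d starting positions of F and its d
    final positions.  The slack C always satisfies an uncrossing inequality, like
    the distance between boundary points of a planar network, where two crossing
    paths meet and can exchange their ends.  Running one more step means summing
    over the previous position of one particle, which takes one of two
    consecutive values.  The number of admissible values is
    [at least one] + [both], and each bracket is again such a system: the first
    is found by eliminating the variable, and elimination keeps slacks planar.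

    For one such system the admissible translations k form an interval, whose
    length is a minimum of sums of two slacks and of heights.  If F takes the
    wider end, that interval is at least as long as if G takes it: a minimum
    attained at crossing chords is compared through uncrossing, and one attained
    at non-crossing chords through the comparison of the gaps
    ([lipschitz_sum_swap]). *)

Set Implicit Arguments.
Unset Strict Implicit.
Unset Printing Implicit Defensive.
Import Order.TTheory GRing.Theory Num.Theory.
Local Open Scope ring_scope.

(** * Families of non-colliding paths and their boundary points *)

Section Families.
Variable d : nat.
Definition vec := {ffun 'I_d -> int}.
Implicit Types (a x y F s : vec).

Definition basis (i : 'I_d) : vec := [ffun j => (j == i)%:Z].

Lemma addvE x y i : (x + y) i = x i + y i. Proof. by rewrite !ffunE. Qed.

Lemma oppvE x i : (- x) i = - x i. Proof. by rewrite !ffunE. Qed.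

Lemma subvE x y i : (x - y) i = x i - y i. Proof. by rewrite !ffunE. Qed.

(** Only neighbours are compared: each inequality between neighbours will become
    a constraint on a chord that no other chord of boundary points can cross. *)
Definition strict x :=
  [forall i : 'I_d, forall j : 'I_d, (j == i.+1 :> nat) ==> (x i < x j)].

Lemma strictP x :
  reflect (forall i j : 'I_d, j = i.+1 :> nat -> x i < x j) (strict x).
Proof.
apply: (iffP forallP) => [h i j /eqP e|h i].
  by have /forallP/(_ j)/implyP/(_ e) := h i.
by apply/forallP=> j; apply/implyP=> /eqP; apply: h.
Qed.

Definition advance (i : 'I_d) (phi : vec -> nat) x : nat :=
  (phi x + phi (x - basis i)%R)%N.

Definition advances (r : seq 'I_d) (phi : vec -> nat) := foldr advance phi r.

Definition step (phi : vec -> nat) x : nat := (strict x * advances (enum 'I_d) phi x)%N.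

(** The number of ways to go from [a] to [x] in [n] steps, as a function of [x]. *)
Definition families a n := iter n step (fun x => (x == a) : nat).

(** [inl i] is the start and [inr i] the end of the path of particle [i]. *)
Local Notation point := ('I_d + 'I_d)%type.
Implicit Types (p q b e z : point).

Definition tip (i : 'I_d) : point := inr i.

(** Boundary points have heights: the positions that [F] occupies there. *)
Definition height a F p := match p with inl i => a i | inr i => F i end.

(** The boundary points in the order in which they follow one another around the
    strip that the paths sweep out: starts from the last particle to the first,
    then ends from the first to the last. *)
Definition pos p : int := match p with inl i => - (i.+1)%:Z | inr i => i%:Z end.

Definition between b e z := (pos b < pos z < pos e) || (pos e < pos z < pos b).

(** The chords [p q] and [b e] of the boundary circle cross. *)
Definition cross p q b e :=
  [&& p != b, p != e, q != b, q != e & between b e p != between b e q].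

Lemma pos_inj : injective pos.
Proof.
by case=> i [] j e; first [congr inl | congr inr | idtac]; try apply: val_inj; move: e; rewrite /pos /=; lia.
Qed.

Lemma cross_sym p q b e : cross p q b e -> cross b e p q.
Proof.
case/and5P=> pb pe qb qe n; rewrite /cross eq_sym pb (eq_sym b) qb (eq_sym e) pe (eq_sym e) qe /=.
move: pb pe qb qe n; rewrite -!(inj_eq pos_inj) /between; lia.
Qed.

(** A point off a chord lies on one of its two sides, while the ends of a
    crossing chord lie on both. *)
Lemma cross_mid z p q b e : z != b -> z != e ->
  cross p q b e -> cross z q b e || cross p z b e.
Proof.
move=> zb ze /and5P[pb pe qb qe n]; rewrite /cross zb ze pb pe qb qe /=.
by case: (between b e p) (between b e q) (between b e z) n => [] [] [].
Qed.

(** Every gap of [x] is at least the corresponding gap of [x']. *)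
Definition wider x x' :=
  forall i j : 'I_d, (i <= j)%N -> x i - x' i <= x j - x' j.

Variables a a' : vec.

Definition lipschitz (C : point -> point -> int) F :=
  [forall p, forall q, height a F p - height a F q <= C p q].

Lemma lipschitzP C F :
  reflect (forall p q, height a F p - height a F q <= C p q) (lipschitz C F).
Proof.
apply: (iffP forallP) => [h p q|h p]; first by have /forallP := h p; apply.
by apply/forallP=> q; apply: h.
Qed.

(** The inequality is uncrossing.  The identity makes the system a symmetric
    condition on the difference [u = F - G = 2 F - s]: it turns [h_p - h_q <= C p q]
    into [u_p - u_q <= C p q + C q p], a bound on the absolute value.  Working with
    [F] instead of [u] avoids a parity condition. *)
Record planar s (C : point -> point -> int) : Prop := Planar {
  uncross : forall p q b e, cross p q b e -> C p e + C b q <= C p q + C b e;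
  compat : forall p q,
    C p q - C q p = height (a + a') s p - height (a + a') s q }.

(** Finite sums of indicators of planar systems. *)
Inductive lipschitz_sum s : (vec -> nat) -> Prop :=
| lipschitz_sum0 f : f =1 (fun=> 0%N) -> lipschitz_sum s f
| lipschitz_sum1 f C : planar s C -> f =1 (fun F => lipschitz C F : nat) -> lipschitz_sum s f
| lipschitz_sumD f g h : lipschitz_sum s f -> lipschitz_sum s g -> h =1 (fun F => (f F + g F)%N) ->
  lipschitz_sum s h.

Lemma lipschitz_sum_ext s f g : lipschitz_sum s f -> f =1 g -> lipschitz_sum s g.
Proof.
move=> H; elim: H g => [f0 h|f0 C c h|f0 g0 h0 H1 IH1 H2 IH2 h] g fg.
- by apply: lipschitz_sum0 => F; rewrite -fg h.
- by apply: (lipschitz_sum1 c) => F; rewrite -fg h.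
- by apply: (lipschitz_sumD H1 H2) => F; rewrite -fg h.
Qed.

Lemma height_sub F i p : height a (F - basis i) p = height a F p - (p == tip i)%:Z.
Proof.
case: p => j //=; first by rewrite subr0.
by rewrite !ffunE.
Qed.

Lemma height_add s i p : height (a + a') (s + basis i) p = height (a + a') s p + (p == tip i)%:Z.
Proof.
case: p => j //=; first by rewrite addr0.
by rewrite !ffunE.
Qed.

(** The systems that arise when the end [z] moves.  [slack_shift]: its previous
    position is one less.  [slack_both]: both its present and its previous height
    are admissible.  [slack_some]: at least one of them is, and the minimum is what
    eliminating the height of [z] imposes on the remaining points; for [p = q] it
    says that the bounds on that height are not contradictory. *)
Definition slack_shift z (C : point -> point -> int) p q : int :=
  C p q + (p == z)%:Z - (q == z)%:Z.
Definition slack_both z (C : point -> point -> int) p q : int :=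
  if p == z then C p q else C p q - (q == z)%:Z.
Definition slack_some z (C : point -> point -> int) p q : int :=
  if p == z then C p q + (q != z)%:Z
  else if q == z then C p q else Num.min (C p q) (C p z + C z q).

Lemma lipschitz_shift C i F :
  lipschitz (slack_shift (tip i) C) F = lipschitz C (F - basis i).
Proof.
apply/lipschitzP/lipschitzP => h p q; move: (h p q);
 rewrite !height_sub /slack_shift; case: (p == tip i); case: (q == tip i) => /=; lia.
Qed.

Lemma lipschitz_both C i F :
  lipschitz (slack_both (tip i) C) F = lipschitz C F && lipschitz C (F - basis i).
Proof.
apply/lipschitzP/andP => [h|[/lipschitzP h /lipschitzP h'] p q].
  split; apply/lipschitzP => p q; move: (h p q); rewrite ?height_sub /slack_both.
    by case: (p == tip i); case: (q == tip i) => /=; lia.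
  by case: (p == tip i); case: (q == tip i) => /=; lia.
move: (h p q) (h' p q); rewrite !height_sub /slack_both.
by case: (p == tip i); case: (q == tip i) => /=; lia.
Qed.

(** The bounds on the height of [z] confine it to an interval with integral
    endpoints, and an interval meets two consecutive integers as soon as each
    lower bound is compatible with each upper bound and with the two integers. *)
Lemma lipschitz_some C i F :
  lipschitz (slack_some (tip i) C) F = lipschitz C F || lipschitz C (F - basis i).
Proof.
set z := tip i.
apply/idP/orP => [/lipschitzP h|].
  have [hF|] := boolP (lipschitz C F); first by left.
  rewrite negb_forall => /existsP[p]; rewrite negb_forall => /existsP[q npq]; right.
  have pz : p = z.
    apply/eqP/negPn/negP => npz; move: (h p q); rewrite /slack_some (negPf npz).
    by case: eqVneq => _; move: npq; lia.
  subst p; have qz : q != z.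
    apply/negP => /eqP qz; subst q; move: (h z z) npq; rewrite /slack_some eqxx; lia.
  (* The present height of [z] violates exactly the bound coming from [q]. *)
  have hq : height a F z - height a F q = C z q + 1.
    by move: (h z q) npq; rewrite /slack_some eqxx qz; lia.
  apply/lipschitzP => u t; rewrite !height_sub -/z.
  have := h u t; rewrite /slack_some.
  case: (eqVneq u z) => [->|nuz]; first by case: (eqVneq t z) => [->|_]; lia.
  case: (eqVneq t z) => [->|ntz]; last by lia.
  by have := h u q; rewrite /slack_some (negPf nuz) (negPf qz); lia.
move=> hor; apply/lipschitzP => p q; rewrite /slack_some.
case: (eqVneq p z) => [->|npz].
  case: hor => /lipschitzP/(_ z q); rewrite ?height_sub -/z ?eqxx; first by lia.
  by case: (eqVneq q z) => [->|_]; lia.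
case: (eqVneq q z) => [->|nqz].
  by case: hor => /lipschitzP/(_ p z); rewrite ?height_sub -/z ?eqxx ?(negPf npz); lia.
case: hor => /lipschitzP h; move: (h p q) (h p z) (h z q);
  rewrite ?height_sub -/z ?eqxx ?(negPf npz) ?(negPf nqz); lia.
Qed.

Lemma lipschitz_advance C i F :
  (lipschitz C F + lipschitz C (F - basis i)%R =
   lipschitz (slack_some (tip i) C) F + lipschitz (slack_both (tip i) C) F)%N.
Proof. by rewrite lipschitz_some lipschitz_both; do 2 case: (lipschitz _ _). Qed.

Lemma cross_neq p q b e : cross p q b e -> [/\ p != q & b != e].
Proof.
case/and5P=> _ _ _ _ n; split; apply/eqP => E; move: n; rewrite E ?eqxx //.
by rewrite /between; lia.
Qed.

Lemma planar_shift s i C :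
  planar s C -> planar (s + basis i + basis i) (slack_shift (tip i) C).
Proof.
case=> X R; split=> [p q b e /X|p q].
  by rewrite /slack_shift; lia.
by move: (R p q); rewrite /slack_shift !height_add; lia.
Qed.

Lemma planar_both s i C : planar s C -> planar (s + basis i) (slack_both (tip i) C).
Proof.
case=> X R; set z := tip i; split=> [p q b e cr|p q]; last first.
  move: (R p q); rewrite /slack_both !height_add -/z.
  by case: (eqVneq p z) => [->|_]; case: (eqVneq q z) => [->|_]; lia.
have [npq nbe] := cross_neq cr; case/and5P: (cr) => npb npe nqb nqe _.
move: (X _ _ _ _ cr); rewrite /slack_both.
case: (eqVneq p z) (eqVneq b z) => [pz|_] [bz|_]; try lia.
- by move: npq npe; rewrite pz !(eq_sym z) => /negPf -> /negPf ->; lia.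
- by move: nqb nbe; rewrite bz (eq_sym z) => /negPf -> /negPf ->; lia.
Qed.

(** If the chords [p e] and [b q] are both rerouted through [z], the bound for
    the uncrossed pair uses the same four slacks as the crossed one.  If only
    one is, the point [z] lies on one side of the other chord, and uncrossing at
    [z] gives the bound. *)
Lemma planar_some s i C : planar s C -> planar (s + basis i) (slack_some (tip i) C).
Proof.
move=> [X R]; set z := tip i; split=> [p q b e cr|p q]; last first.
  move: (R p q) (R p z) (R z q); rewrite /slack_some !height_add -/z.
  by case: (eqVneq p z) => [->|_]; case: (eqVneq q z) => [->|_]; lia.
have [npq nbe] := cross_neq cr; case/and5P: (cr) => npb npe nqb nqe _.
have X0 := X _ _ _ _ cr; rewrite /slack_some.
have [pz|/negPf pz] := eqVneq p z.
  subst p; rewrite (eq_sym q) (negPf npq) (eq_sym e) (negPf npe) (eq_sym b) (negPf npb).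
  by rewrite /=; lia.
have [bz|/negPf bz] := eqVneq b z.
  by subst b; rewrite (negPf nqb) (eq_sym e) (negPf nbe) /=; lia.
have [qz|/negPf qz] := eqVneq q z.
  subst q; rewrite (eq_sym e) (negPf nqe) /=; lia.
have [ez|/negPf ez] := eqVneq e z; first by subst e; lia.
have zb : z != b by rewrite eq_sym bz.
have ze : z != e by rewrite eq_sym ez.
have zp : z != p by rewrite eq_sym pz.
have zq : z != q by rewrite eq_sym qz.
have := cross_mid zp zq (cross_sym cr); have := cross_mid zb ze cr.
move=> h1 h2; move: X0.
have [mpe1 mpe2] : Num.min (C p e) (C p z + C z e) <= C p e /\
  Num.min (C p e) (C p z + C z e) <= C p z + C z e by rewrite !ge_min !lexx orbT.
have [mbq1 mbq2] : Num.min (C b q) (C b z + C z q) <= C b q /\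
  Num.min (C b q) (C b z + C z q) <= C b z + C z q by rewrite !ge_min !lexx orbT.
move: mpe1 mpe2 mbq1 mbq2; move: (Num.min (C p e) _) (Num.min (C b q) _) => u v.
move: h1 h2; clear -X.
case: (leP (C p q) (C p z + C z q)) => _; case: (leP (C b e) (C b z + C z e)) => _ h1 h2; [lia | | | lia].
  by case/orP: h2 => /X; lia.
by case/orP: h1 => /X; lia.
Qed.

Lemma lipschitz_sum_shift s i f :
  lipschitz_sum s f -> lipschitz_sum (s + basis i + basis i) (fun F => f (F - basis i)).
Proof.
elim=> [f0 h|f0 C c h|f0 g0 h0 _ IH1 _ IH2 h].
- by apply: lipschitz_sum0 => F; rewrite h.
- by apply: (lipschitz_sum1 (planar_shift i c)) => F; rewrite h lipschitz_shift.
- by apply: (lipschitz_sumD IH1 IH2) => F; rewrite h.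
Qed.

Lemma lipschitz_sum_advance s i f : lipschitz_sum s f -> lipschitz_sum (s + basis i) (advance i f).
Proof.
elim=> [f0 h|f0 C c h|f0 g0 h0 _ IH1 _ IH2 h].
- by apply: lipschitz_sum0 => F; rewrite /advance !h.
- have H1 := lipschitz_sum1 (planar_some i c) (fun=> erefl).
  have H2 := lipschitz_sum1 (planar_both i c) (fun=> erefl).
  by apply: (lipschitz_sumD H1 H2) => F; rewrite /advance !h lipschitz_advance.
- by apply: (lipschitz_sumD IH1 IH2) => F; rewrite /advance !h; lia.
Qed.

(** The condition that neither [F] nor [s - F] has a collision. *)
Definition slack_cut s (C : point -> point -> int) p q : int :=
  match p, q with
  | inr i, inr j =>
    if j == i.+1 :> nat then Num.min (C p q) (-1)
    else if i == j.+1 :> nat then Num.min (C p q) (s i - s j - 1)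
    else C p q
  | _, _ => C p q
  end.

Lemma slack_cut_le s C p q : slack_cut s C p q <= C p q.
Proof.
case: p q => i [] j //=; case: ifP => _; first by lia.
by case: ifP => _; lia.
Qed.

(** Neighbouring ends bound an empty arc, so a chord between them crosses
    nothing; lowering its slack leaves the larger side of uncrossing alone. *)
Lemma slack_cut_cross s C p q b e : cross p q b e -> slack_cut s C p q = C p q.
Proof.
case: p q => i [] j //= /and5P[pb pe qb qe n].
have adj : ~ (j = i.+1 :> nat \/ i = j.+1 :> nat).
  move: pb pe qb qe n; rewrite -!(inj_eq pos_inj) /between /=; lia.
by case: eqP => [E|_]; [case: adj; left | case: eqP => [E|//]; case: adj; right].
Qed.

Lemma planar_cut s C : planar s C -> planar s (slack_cut s C).
Proof.
case=> X R; split=> [p q b e cr|p q].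
  rewrite (slack_cut_cross s C cr) (slack_cut_cross s C (cross_sym cr)).
  by move: (X _ _ _ _ cr) (slack_cut_le s C p e) (slack_cut_le s C b q); lia.
case: p q => i [] j; rewrite /slack_cut; move: (R (inr i) (inr j)) => /=; try by move=> _; apply: R.
by case: eqP => e1; case: eqP => e2; lia.
Qed.

Lemma lipschitz_cut s C F :
  lipschitz (slack_cut s C) F = [&& strict F, strict (s - F) & lipschitz C F].
Proof.
apply/lipschitzP/and3P => [h|[/strictP h1 /strictP h2 /lipschitzP h3] p q].
  split.
  - apply/strictP => i j e; move: (h (inr i) (inr j)).
    by rewrite /slack_cut /= e eqxx; lia.
  - apply/strictP => i j e; move: (h (inr j) (inr i)); rewrite !ffunE.
    rewrite /slack_cut /= e eqxx; case: eqP => [|_]; lia.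
  - by apply/lipschitzP => p q; apply: le_trans (h p q) (slack_cut_le _ _ _ _).
move: (h3 p q); case: p q => i [] j //=.
case: eqP => [/h1|_]; first by rewrite le_min => + -> /=; lia.
by case: eqP => [/h2|_ //]; rewrite !subvE le_min => + -> /=; lia.
Qed.

Lemma lipschitz_sum_cut s f : lipschitz_sum s f ->
  lipschitz_sum s (fun F => strict F * strict (s - F)%R * f F)%N.
Proof.
elim=> [f0 h|f0 C c h|f0 g0 h0 _ IH1 _ IH2 h].
- by apply: lipschitz_sum0 => F; rewrite h muln0.
- apply: (lipschitz_sum1 (planar_cut c)) => F; rewrite h lipschitz_cut.
  by case: (strict F); case: (strict (s - F)); case: (lipschitz C F).
- by apply: (lipschitz_sumD IH1 IH2) => F; rewrite h mulnDr.
Qed.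

(** * Starting configuration and time evolution *)

Definition src (c : vec) p := match p with inl i => c i | inr i => c i end.

(** The system that forces [F = a], with all its other slacks as small as the
    positions [a] of [F] and [a'] of [G] allow. *)
Definition slack_start p q : int :=
  Num.max (src a p - src a q) (src a' p - src a' q).

Definition index_of p : nat := match p with inl i => i | inr i => i end.

Lemma wider_src p q : wider a a' -> (index_of p <= index_of q)%N ->
  src a p - src a' p <= src a q - src a' q.
Proof. by move=> w; case: p q => i [] j /= /w. Qed.

(** Up to a potential, the slack is the positive part of a difference of
    [a - a'], which is monotone along each of the two arcs of starts and ends.
    When two chords cross, neither has both its indices below both indices of the
    other; uncrossing is then the convexity of the positive part, or an equality. *)
Lemma planar_start : wider a a' -> planar (a + a') slack_start.
Proof.
move=> w; split=> [p q b e cr|p q]; last first.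
  by rewrite /slack_start; case: p q => i [] j /=; rewrite ?addvE; lia.
have cr' := cross_sym cr.
have W u v := @wider_src u v w; rewrite /slack_start.
have hpq := leq_total (index_of p) (index_of b).
have hqe := leq_total (index_of q) (index_of e).
have hpe := leq_total (index_of p) (index_of e).
have hqb := leq_total (index_of q) (index_of b).
have key : ((index_of p <= index_of b)%N && (index_of q <= index_of e)%N ->
     (index_of e <= index_of p)%N || (index_of b <= index_of q)%N) /\
    ((index_of b <= index_of p)%N && (index_of e <= index_of q)%N ->
     (index_of p <= index_of e)%N || (index_of q <= index_of b)%N).
  case/and5P: cr; rewrite -!(inj_eq pos_inj) /between.
  by case: p q b e {W hpq hqe hpe hqb cr'} => i [] j [] k [] l /=; lia.
have [K1 K2] := key.
case/orP: hpq => /[dup] /W w1 h1; case/orP: hqe => /[dup] /W w2 h2;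
case/orP: hpe => /W w3; case/orP: hqb => /W w4; try lia.
- by move: K1; rewrite h1 h2 => /(_ isT)/orP[/W|/W]; lia.
- by move: K2; rewrite h1 h2 => /(_ isT)/orP[/W|/W]; lia.
Qed.

Lemma lipschitz_start F : lipschitz slack_start F = (F == a).
Proof.
apply/lipschitzP/eqP => [h|-> p q]; last first.
  have hE z : height a a z = src a z by case: z.
  by rewrite !hE /slack_start; lia.
apply/ffunP => i; move: (h (inl i) (inr i)) (h (inr i) (inl i)).
by rewrite /slack_start /=; lia.
Qed.

Lemma lipschitz_sum_start s : wider a a' ->
  lipschitz_sum s (fun F => (F == a) * (s - F == a')%R)%N.
Proof.
move=> w; have [->|ns] := eqVneq s (a + a').
  apply: (lipschitz_sum1 (planar_start w)) => F; rewrite lipschitz_start.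
  by have [->|//] := eqVneq F a; rewrite [a + a']addrC addrK eqxx.
apply: lipschitz_sum0 => F; have [->|//] := eqVneq F a.
by rewrite mul1n subr_eq addrC (negPf ns).
Qed.

(** The advance of one particle in both families has four cases: neither path
    moves, exactly one of them does, or both do.  The middle two make up an
    [advance] of [F] for a sum that is smaller by one. *)
Lemma lipschitz_sum_advances (r : seq 'I_d) (phi psi : vec -> nat) :
  (forall s, lipschitz_sum s (fun F => phi F * psi (s - F)%R)%N) ->
  forall s, lipschitz_sum s (fun F => advances r phi F * advances r psi (s - F)%R)%N.
Proof.
move=> H; elim: r => [|i r IH] s //=.
have [s2 sE] : exists s2, s = s2 + basis i + basis i.
  by exists (s - basis i - basis i); rewrite !subrK.
set f := fun s F => (advances r phi F * advances r psi (s - F)%R)%N.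
rewrite {1}sE; have H0 : lipschitz_sum (s2 + basis i + basis i) (f s) by rewrite -sE; apply: IH.
have H1 := lipschitz_sum_advance i (IH (s2 + basis i)).
have H2 := lipschitz_sum_shift i (IH s2).
apply: (lipschitz_sumD (lipschitz_sumD H0 H1 (fun=> erefl)) H2) => F.
have e1 : s2 + basis i - F = s - F - basis i.
  by apply/ffunP=> j; rewrite sE !(addvE, oppvE); lia.
have e2 : s2 + basis i - (F - basis i) = s - F.
  by apply/ffunP=> j; rewrite sE !(addvE, oppvE); lia.
have e3 : s2 - (F - basis i) = s - F - basis i.
  by apply/ffunP=> j; rewrite sE !(addvE, oppvE); lia.
rewrite /advance /f e1 e2 e3.
move: (advances r phi F) (advances r phi _) (advances r psi _) (advances r psi _) => A B D E; lia.
Qed.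

(** For a given total [s], the number of pairs of families of the same length. *)
Lemma lipschitz_sum_families n s : wider a a' ->
  lipschitz_sum s (fun F => families a n F * families a' n (s - F)%R)%N.
Proof.
move=> w; elim: n s => [|n IH] s; first exact: lipschitz_sum_start.
apply: lipschitz_sum_ext (lipschitz_sum_cut (lipschitz_sum_advances (enum 'I_d) IH s)) _ => F.
by rewrite /families !iterS /step /=; lia.
Qed.

Definition const_vec (k : int) : vec := [ffun=> k].

Lemma const_vecE k i : const_vec k i = k. Proof. by rewrite ffunE. Qed.

(** * The wider end goes with the wider start *)

(** On the right [F] ends at a translate of [x], on the left at a translate of
    [x'], and [G] takes the other end.  For one system the admissible [k] on
    either side form an interval, from the largest lower bound to the smallest
    upper bound, each of them coming from a chord between a start and an end.
    A pair of chords bounding the interval on the right is matched with a pair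
    of chords bounding the interval on the left that allows no more room. *)
Lemma lipschitz_sum_swap (i0 : 'I_d) x x' (t : nat) (f : vec -> nat) :
  wider a a' -> wider x x' ->
  (forall k : int, ~~ (0 <= k <= t%:Z) -> f (x + const_vec k) = 0%N) ->
  lipschitz_sum (x + x' + const_vec t) f ->
  (\sum_(k < t.+1) f (x' + const_vec k)%R <= \sum_(k < t.+1) f (x + const_vec k)%R)%N.
Proof.
move=> wa wx supp H; elim: H supp => [f0 h _|f0 C [X R] h supp|f0 g0 h0 _ IH1 _ IH2 h supp].
- by rewrite big1 // => k _; rewrite h.
- pose P y (k : int) := lipschitz C (y + const_vec k).
  have PE y k : f0 (y + const_vec k) = P y k by rewrite h.
  under eq_bigr do rewrite PE; under [X in (_ <= X)%N]eq_bigr do rewrite PE.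
  have sumE y : (\sum_(k < t.+1) (P y k : nat) = #|[set k : 'I_t.+1 | P y k]|)%N.
    by rewrite -sum1dep_card [RHS]big_mkcond /=; apply: eq_bigr => k _; case: (P y k).
  rewrite !sumE.
  have [->|/set0Pn[k0]] := eqVneq [set k : 'I_t.+1 | P x' k] set0; first by rewrite cards0.
  rewrite inE => Pk0.
  case: (arg_minnP (P := fun k : 'I_t.+1 => P x' k) (fun k => k : nat) Pk0) => al Pal almin.
  case: (arg_maxnP (P := fun k : 'I_t.+1 => P x' k) (fun k => k : nat) Pk0) => be Pbe bemax.
  have [i [j mx]] : exists i j : 'I_d, forall i' j' : 'I_d,
      a i' - x j' - C (inl i') (inr j') <= a i - x j - C (inl i) (inr j).
    pose lower (ij : 'I_d * 'I_d) := a ij.1 - x ij.2 - C (inl ij.1) (inr ij.2).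
    case: (@Order.TotalTheory.arg_maxP _ int _ (i0, i0) xpredT lower isT) => [[i j] _ mx].
    by exists i, j => i' j'; apply: (mx (i', j')).
  (* [ga] is the first admissible translation on the right. *)
  pose ga := a i - x j - C (inl i) (inr j).
  (* The right interval contains a translate of the segment from [al] to [be]. *)
  have key (c : int) : 0 <= c <= be%:Z - al%:Z -> P x (ga + c).
    move=> hc.
    have cst y (k : int) l : (y + const_vec k) l = y l + k by rewrite addvE const_vecE.
    have La p q := lipschitzP _ _ Pal p q.
    have Lb p q := lipschitzP _ _ Pbe p q.
    have Rel p q : C p q - C q p = height (a + a') (x + x' + const_vec t) p
        - height (a + a') (x + x' + const_vec t) q by apply: R.
    apply/lipschitzP => -[k|l] [k'|l'] /=; rewrite ?cst.
    - exact: (La (inl k) (inl k')).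
    - by move: (mx k l'); rewrite /= /ga; lia.
    - have up (k1 l1 : 'I_d) : be%:Z <= x l1 - a' k1 + C (inl k1) (inr l1) + t%:Z.
        by move: (Lb (inr l1) (inl k1)) (Rel (inr l1) (inl k1)) => /=; rewrite !addvE !const_vecE; lia.
      have dn (i1 j1 : 'I_d) : a i1 - x' j1 - C (inl i1) (inr j1) <= al%:Z.
        by move: (La (inl i1) (inr j1)) => /=; rewrite !addvE !const_vecE; lia.
      have Rkl := Rel (inr l) (inl k'); rewrite /= !addvE !const_vecE in Rkl.
      suff : a i - x j - C (inl i) (inr j) + (be%:Z - al%:Z) <=
             x' l - a' k' + C (inl k') (inr l) + t%:Z by rewrite /ga; lia.
      (* The lower bound comes from the chord from [i] to [j], the upper one from
         the chord from [k'] to [l]. *)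
      have [jl|jl] := leqP l j.
        by move: (wx _ _ jl) (dn i j) (up k' l); lia.
      have [ik|ik] := leqP i k'.
        by move: (wa _ _ ik) (dn k' l) (up i j); lia.
      have cr : cross (inl k') (inr l) (inl i) (inr j).
        by rewrite /cross -!(inj_eq pos_inj) /between /=; lia.
      by move: (X _ _ _ _ cr) (dn i l) (up k' j); lia.
    - move: (La (inr l') (inr l)) (Rel (inr l') (inr l)) => /=.
      by rewrite !addvE !const_vecE; lia.
  have inw (k : 'I_t.+1) : P x' k -> 0 <= ga + (k%:Z - al%:Z) <= t%:Z /\ P x (ga + (k%:Z - al%:Z)).
    move=> Pk; have Pg : P x (ga + (k%:Z - al%:Z)).
      by apply: key; move: (almin k Pk) (bemax k Pk) => /=; lia.
    by split=> //; apply/negPn/negP => /supp; rewrite PE Pg.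
  pose g (k : 'I_t.+1) : 'I_t.+1 := inord `|(ga + (k%:Z - al%:Z))%R|%N.
  have gE (k : 'I_t.+1) : P x' k -> (g k : nat)%:Z = ga + (k%:Z - al%:Z).
    by move=> /inw[w _]; rewrite inordK; lia.
  have ginj : {in [set k : 'I_t.+1 | P x' k] &, injective g}.
    move=> k1 k2; rewrite !inE => P1 P2 e; apply: val_inj => /=.
    by move: (gE _ P1) (gE _ P2); rewrite e; lia.
  rewrite -(card_in_imset ginj); apply: subset_leq_card.
  apply/subsetP => _ /imsetP[k Pk ->]; rewrite !inE in Pk *.
  by rewrite gE //; have [] := inw k Pk.
- rewrite (eq_bigr _ (fun k _ => h _)) (eq_bigr _ (fun k _ => h _)) !big_split /= leq_add //.
    by apply: IH1 => k /supp; rewrite h; lia.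
  by apply: IH2 => k /supp; rewrite h; lia.
Qed.

End Families.

(** * Decomposition of families of paths *)

Section Count.
Variable d : nat.
Implicit Types (a x y : vec d) (A : {set 'I_d}) (phi psi : vec d -> nat).

Definition indicator A : vec d := [ffun i => (i \in A)%:Z].

Lemma advances_powerset (r : seq 'I_d) phi x : uniq r ->
  advances r phi x =
  (\sum_(A in powerset [set i in r]) phi (x - indicator A)%R)%N.
Proof.
elim: r x => [|i r IH] x /=.
  move=> _; have -> : [set i : 'I_d in [::]] = set0 by apply/setP=> i; rewrite !inE.
  rewrite powerset0 big_set1; congr phi.
  by apply/ffunP=> i; rewrite !ffunE inE subr0.
case/andP=> ir ur; rewrite /advance !IH //.
set R := [set j in r]; have iR : i \notin R by rewrite inE.
have -> : [set j in i :: r] = i |: R by apply/setP=> j; rewrite !inE.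
have RE A : A \subset R -> i \notin A by move=> AR; apply: contra iR; apply: (subsetP AR).
rewrite [RHS](bigID (fun A => i \in A)) addnC /=; congr addn; last first.
  apply: eq_bigl => A; rewrite !powersetE; apply/idP/andP => [AR|[AR iA]].
    by split; [exact: subset_trans AR (subsetUr _ _) | exact: RE].
  apply/subsetP=> j jA; have := subsetP AR _ jA.
  by rewrite in_setU1 => /orP[/eqP E|//]; rewrite -E jA in iA.
rewrite [RHS](reindex_onto (fun A => i |: A) (fun A => A :\ i)) /=; last first.
  by move=> A /andP[_ iA]; rewrite setD1K.
apply: eq_big => [A|A]; rewrite !powersetE.
  rewrite setU11 andbT; apply/idP/andP => [AR|[AR /eqP E]].
    by split; [exact: setUS | rewrite setU1K // RE].
  have iA : i \notin A by rewrite -E setD11.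
  apply/subsetP=> j jA; have := subsetP AR j; rewrite !in_setU1 jA orbT => /(_ isT).
  by case/orP=> [/eqP e|//]; rewrite -e jA in iA.
move=> /RE iA; congr phi; apply/ffunP=> j; rewrite !ffunE in_setU1.
by have [->|] := eqVneq j i; [rewrite (negPf iA) | ]; case: (_ \in A) => //=; lia.
Qed.

Lemma advancesE phi x :
  advances (enum 'I_d) phi x = (\sum_(A : {set 'I_d}) phi (x - indicator A)%R)%N.
Proof.
rewrite advances_powerset ?enum_uniq //; apply: eq_bigl => A.
by rewrite powersetE; apply/subsetP=> i _; rewrite inE mem_enum.
Qed.

Lemma step_linear (T : Type) (L : seq T) (F : T -> vec d -> nat) phi :
  phi =1 (fun y => \sum_(b <- L) F b y)%N ->
  step phi =1 (fun y => \sum_(b <- L) step (F b) y)%N.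
Proof.
move=> e x; rewrite /step advancesE.
under [RHS]eq_bigr do rewrite advancesE.
rewrite -big_distrr exchange_big /=; congr muln.
by apply: eq_bigr => A _; rewrite e.
Qed.

Lemma iter_step_linear n (T : Type) (L : seq T) (F : T -> vec d -> nat) phi :
  phi =1 (fun y => \sum_(b <- L) F b y)%N ->
  iter n (@step d) phi =1 (fun y => \sum_(b <- L) iter n (@step d) (F b) y)%N.
Proof. by elim: n => // n IH e; apply: step_linear; apply: IH. Qed.

Definition origin : vec d := [ffun i : 'I_d => (i : nat)%:Z].

Lemma strict_wider x : strict x -> wider x origin.
Proof.
move=> /strictP sx.
have H n (i j : 'I_d) : j = (i + n)%N :> nat -> x i - i%:Z <= x j - j%:Z.
  elim: n j => [|n IH] j; first by rewrite addn0 => /val_inj ->.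
  rewrite addnS => e.
  have lt : (i + n < d)%N by rewrite -ltnS -e ltnS ltnW.
  have := sx (Ordinal lt) j e; have := IH (Ordinal lt) erefl.
  by rewrite e /=; lia.
by move=> i j ij; rewrite !ffunE; apply: (H (j - i)%N); rewrite subnKC.
Qed.

Lemma families_ge a n x i : families a n x != 0%N -> a i <= x i.
Proof.
elim: n x => [|n IH] x; first by rewrite /families /=; case: (x =P a) => [->|].
rewrite /families iterS /step advancesE muln_eq0 sum_nat_eq0 negb_or negb_forall.
case/andP=> _ /existsP[A /= nz].
by have := IH _ nz; rewrite subvE ffunE; lia.
Qed.

Lemma strict_origin : strict origin.
Proof. by apply/strictP=> i j e; rewrite !ffunE e; lia. Qed.

Lemma families_strict n x : families origin n x != 0%N -> strict x.
Proof.
case: n => [|n]; first by rewrite /families /=; case: (x =P origin) => [->|//]; rewrite strict_origin.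
by rewrite /families iterS /step muln_eq0 negb_or => /andP[]; case: (strict x).
Qed.

Definition successors a := [seq a + indicator A | A <- enum {set 'I_d} & strict (a + indicator A)].

Lemma families_successors a n x :
  families a n.+1 x = (\sum_(b <- successors a) families b n x)%N.
Proof.
rewrite /families iterSr; apply: iter_step_linear => y.
rewrite /step advancesE /successors big_map big_filter big_enum_cond /=.
rewrite [RHS]big_mkcond big_distrr; apply: eq_bigr => A _ /=.
rewrite subr_eq; have [->|] := eqVneq y (a + indicator A); first by case: strict.
by case: (strict y); case: (strict (a + _)).
Qed.

(** Cutting the first [E] steps off: a family from [origin] is a family from
    one of finitely many intermediate configurations, listed with multiplicity. *)
Lemma families_split E : exists L : seq (vec d),
  (forall a, a \in L -> strict a /\ forall i, 0 <= a i) /\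
  forall n x, families origin (E + n) x = (\sum_(a <- L) families a n x)%N.
Proof.
elim: E => [|E [L [LP LE]]].
  exists [:: origin]; split=> [a|n x]; last by rewrite big_seq1.
  by rewrite inE => /eqP ->; split=> [|i]; [exact: strict_origin | rewrite ffunE].
exists (flatten [seq successors a | a <- L]); split=> [b|n x].
  case/flatten_mapP=> a /LP[_ a0] /mapP[A]; rewrite mem_filter => /andP[sb _] ->.
  by split=> // i; move: (a0 i); rewrite addvE ffunE; lia.
rewrite addSnnS LE big_flatten big_map; apply: eq_bigr => a _.
exact: families_successors.
Qed.

Lemma strict_translate x k : strict (x + const_vec d k) = strict x.
Proof.
by apply/strictP/strictP => h i j /h; rewrite !addvE !const_vecE; lia.
Qed.

(** The two sides assign the ends [origin] and [y] to the families of lengths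
    [n] and [m] in the two possible ways. *)
Lemma swap_ends_le (n m t : nat) (A : {set 'I_d}) (i0 : 'I_d) y : (m <= n)%N -> i0 = 0%N :> nat ->
  y = origin - indicator A ->
  (\sum_(k < t.+1) families origin n (origin + const_vec d k)%R *
                    families origin m (y + const_vec d (t%:Z - k%:Z))%R <=
   \sum_(k < t.+1) families origin n (y + const_vec d k)%R *
                    families origin m (origin + const_vec d (t%:Z - k%:Z))%R)%N.
Proof.
move=> mn i00 yE; have [sy|nsy] := boolP (strict y); last first.
  rewrite big1 // => k _.
  have [->|/families_strict] := eqVneq (families origin m (y + const_vec d (t%:Z - k%:Z))) 0%N.
    by rewrite muln0.
  by rewrite strict_translate (negPf nsy).
have [L [LP LE]] := families_split (n - m).
have nE x : families origin n x = (\sum_(a <- L) families a m x)%N.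
  by rewrite -LE subnK.
under eq_bigr do rewrite nE big_distrl /=.
under [X in (_ <= X)%N]eq_bigr do rewrite nE big_distrl /=.
rewrite exchange_big [X in (_ <= X)%N]exchange_big /=.
rewrite big_seq [X in (_ <= X)%N]big_seq; apply: leq_sum => a /LP[sa a0].
set s := y + origin + const_vec d t.
pose f F := (families a m F * families origin m (s - F)%R)%N.
have fy (k : int) : f (y + const_vec d k) = (families a m (y + const_vec d k)%R *
     families origin m (origin + const_vec d (t%:Z - k))%R)%N.
  rewrite /f; congr (_ * families _ _ _)%N.
  by apply/ffunP=> i; rewrite /s !(addvE, oppvE, const_vecE); lia.
have fo (k : int) : f (origin + const_vec d k) = (families a m (origin + const_vec d k)%R *
     families origin m (y + const_vec d (t%:Z - k))%R)%N.
  rewrite /f; congr (_ * families _ _ _)%N.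
  by apply/ffunP=> i; rewrite /s !(addvE, oppvE, const_vecE); lia.
under eq_bigr do rewrite -fo; under [X in (_ <= X)%N]eq_bigr do rewrite -fy.
apply: (lipschitz_sum_swap i0 (strict_wider sa) (strict_wider sy)); last first.
  exact: lipschitz_sum_families (strict_wider sa).
move=> k kt; apply/eqP/negPn/negP; rewrite fy muln_eq0 negb_or => /andP[/families_ge h1 /families_ge h2].
move: (h1 i0) (h2 i0) (a0 i0) kt; rewrite yE !(addvE, oppvE, const_vecE) !ffunE i00; lia.
Qed.

(** This is the coefficient of degree [t] in the product of the Hoggatt
    polynomials of [n] and [m]; see [coef_packed_pairs]. *)
Definition packed_pairs n m t := (\sum_(k < t.+1) families origin n (origin + const_vec d k)%R *
  families origin m (origin + const_vec d (t%:Z - k%:Z))%R)%N.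

Lemma packed_pairs_le (n m t : nat) : (0 < d)%N -> (m <= n)%N ->
  (packed_pairs n m.+1 t <= packed_pairs n.+1 m t)%N.
Proof.
move=> d0 mn; pose i0 : 'I_d := Ordinal d0.
have sE n' (k : int) : families origin n'.+1 (origin + const_vec d k) =
    (\sum_(A : {set 'I_d}) families origin n' (origin - indicator A + const_vec d k)%R)%N.
  rewrite [LHS]/(step (families origin n') _) /step strict_translate strict_origin mul1n advancesE.
  by apply: eq_bigr => A _; rewrite addrAC.
rewrite /packed_pairs.
under eq_bigr do rewrite sE big_distrr /=.
under [X in (_ <= X)%N]eq_bigr do rewrite sE big_distrl /=.
rewrite exchange_big [X in (_ <= X)%N]exchange_big /=.
by apply: leq_sum => A _; apply: (swap_ends_le t (A := A) (i0 := i0)).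
Qed.

End Count.

(** * The product formula *)

Section Product.
Variables (R : numFieldType) (d : nat).
Implicit Types (x : vec d) (A : {set 'I_d}).

(** The reciprocal of [z! (M - 1 - z)!], extended by zero outside the sites
    [0, ..., M - 1] where it makes sense; this is what keeps the particles inside. *)
Definition recip (M : nat) (z : int) : R :=
  if z is Posz k then if (k < M)%N then ((k`! * (M - k.+1)`!)%:R)^-1 else 0 else 0.

Lemma fact_neq0 n : n`!%:R != 0 :> R.
Proof. by rewrite pnatr_eq0 -lt0n fact_gt0. Qed.

Lemma recip_stay M z : recip M z = (M%:R - z%:~R) * recip M.+1 z.
Proof.
case: z => k /=; last by rewrite mulr0.
rewrite ltnS; have [kM|Mk] := leqP M k.
  have [kM'|] := leqP k M; last by rewrite mulr0.
  by rewrite (_ : k = M) -?pmulrn ?subrr ?mul0r //; lia.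
rewrite (ltnW Mk) subSS -pmulrn -natrB ?(ltnW Mk) //.
have -> : (M - k = (M - k.+1).+1)%N by lia.
rewrite factS !natrM; field.
by rewrite !fact_neq0 nat1r pnatr_eq0.
Qed.

Lemma recip_move M z : recip M (z - 1) = z%:~R * recip M.+1 z.
Proof.
case: z => [[|k]|k].
- by rewrite mul0r.
- have -> : Posz k.+1 - 1 = Posz k by lia.
  rewrite -pmulrn /= ltnS subSS; case: ifP => kM; last by rewrite mulr0.
  rewrite factS !natrM; field.
  by rewrite !fact_neq0 nat1r pnatr_eq0.
- by rewrite (_ : Negz k - 1 = Negz k.+1) ?mulr0 //; lia.
Qed.

Definition vdm x : R := \det (\matrix_(i < d, j < d) (x i)%:~R ^+ j).

Lemma vdmE x : vdm x = \prod_(i < d) \prod_(j < d | (i < j)%N) ((x j)%:~R - (x i)%:~R).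
Proof.
rewrite /vdm -det_tr.
have -> : (\matrix_(i < d, j < d) (x i)%:~R ^+ j)^T =
    Vandermonde d (\row_(j < d) (x j)%:~R : 'rV[R]_d).
  by apply/matrixP=> i j; rewrite !mxE.
by rewrite det_Vandermonde; do 2 (apply: eq_bigr => ? _); rewrite !mxE.
Qed.

(** At position [z], advancing has weight [z] and staying has weight [M - z]; the
    weighted sum of the two previous entries [(z - 1)^j] and [z^j] of the
    Vandermonde determinant is the value of this polynomial at [z]. *)
Definition vdm_poly (M : R) (j : nat) : {poly R} :=
  'X * ('X - 1%:P) ^+ j + (M%:P - 'X) * 'X^j.

Lemma vdm_poly_coef M j m : (j <= m)%N ->
  (vdm_poly M j)`_m = if m == j then M - j%:R else 0.
Proof.
pose D j : {poly R} := ('X - 1%:P) ^+ j - 'X^j.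
have H : forall j, (forall m, (j <= m)%N -> (D j)`_m = 0) /\ (D j * 'X)`_j = - j%:R.
  elim=> [|k [IH1 IH2]]; first by rewrite /D !expr0 subrr mul0r; split=> [m0 _|]; rewrite coef0 // oppr0.
  have DS : D k.+1 = D k * 'X - D k - 'X^k by rewrite /D !exprS; ring.
  rewrite DS; move: {DS} (D k) IH1 IH2 => P IH1 IH2.
  split=> [m' km|].
    rewrite !coefB coefMX coefXn (gtn_eqF km) (IH1 m' (ltnW km)) !subr0.
    by case: m' km => [//|m'] km /=; rewrite IH1.
  rewrite coefMX /= !coefB IH2 IH1 // coefXn eqxx subr0 -[k.+1%:R]natr1 opprD //.
move=> jm; have [H1 H2] := H j.
have -> : vdm_poly M j = M *: 'X^j + D j * 'X.
  by rewrite /vdm_poly /D -mul_polyC; ring.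
rewrite coefD coefZ coefXn; have [->|nm] := eqVneq m j; first by rewrite mulr1 H2.
have {jm} jm : (j < m)%N by rewrite ltn_neqAle eq_sym nm.
rewrite mulr0 add0r coefMX; by case: m jm {nm} => // m jm /=.
Qed.

(** Expanding the determinants turns the sum over [A] into a product over rows.
    The new entries are polynomials in the row variable whose degree is at most
    the column index, so they are the Vandermonde matrix times a triangular one. *)
Lemma vdm_sum (M : R) x :
  \sum_(A : {set 'I_d}) vdm (x - indicator A) *
     \prod_i (if i \in A then (x i)%:~R else M - (x i)%:~R) =
  (\prod_(j < d) (M - j%:R)) * vdm x.
Proof.
pose T := \matrix_(m < d, j < d) (vdm_poly M j)`_m.
have -> : \prod_(j < d) (M - j%:R) = \det T.
  rewrite -det_tr det_trig; first by apply: eq_bigr => j _; rewrite !mxE vdm_poly_coef // eqxx.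
  apply/is_trig_mxP => i j ij; rewrite !mxE vdm_poly_coef ?(ltnW ij) //.
  by rewrite (gtn_eqF ij).
rewrite mulrC -det_mulmx.
have -> : (\matrix_(i < d, j < d) (x i)%:~R ^+ j) *m T =
   \matrix_(i < d, j < d) ((x i)%:~R * ((x i)%:~R - 1) ^+ j + (M - (x i)%:~R) * (x i)%:~R ^+ j).
  apply/matrixP=> i j; rewrite !mxE.
  have sz : (size (vdm_poly M j) <= d)%N.
    apply/leq_sizeP => m dm; have jm : (j < m)%N := leq_trans (ltn_ord j) dm.
    by rewrite vdm_poly_coef ?(ltnW jm) // (gtn_eqF jm).
  transitivity (vdm_poly M j).[(x i)%:~R].
    rewrite (horner_coef_wide _ sz); apply: eq_bigr => m _.
    by rewrite !mxE mulrC.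
  by rewrite /vdm_poly !hornerE.
rewrite /vdm /determinant.
transitivity (\sum_(A : {set 'I_d}) \sum_(s : 'S_d) (-1) ^+ s *
   \prod_i (if i \in A then (x i)%:~R * ((x i)%:~R - 1) ^+ s i
            else (M - (x i)%:~R) * (x i)%:~R ^+ s i)).
  apply: eq_bigr => A _; rewrite big_distrl; apply: eq_bigr => s _ /=.
  rewrite -mulrA -big_split /=; congr (_ * _); apply: eq_bigr => i _.
  rewrite !mxE subvE ffunE; case: (i \in A); rewrite mulrC //.
    by rewrite intrB.
  by rewrite subr0.
rewrite exchange_big; apply: eq_bigr => s _; rewrite -big_distrr /=; congr (_ * _).
rewrite -bigA_distr; apply: eq_bigr => i _; by rewrite !mxE.
Qed.

Lemma vdm_recip_sum M x :
  \sum_(A : {set 'I_d}) vdm (x - indicator A) *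
     \prod_i recip M ((x - indicator A) i) =
  (\prod_(j < d) (M%:R - j%:R)) * (vdm x * \prod_i recip M.+1 (x i)).
Proof.
rewrite mulrA -vdm_sum big_distrl; apply: eq_bigr => A _ /=.
rewrite -mulrA -big_split; congr (_ * _); apply: eq_bigr => i _ /=.
rewrite subvE ffunE; case: (i \in A); first exact: recip_move.
by rewrite subr0 recip_stay.
Qed.

Definition weight n : R := \prod_(i < d) ((n + i)`! * i`!)%:R.

Lemma weightS n : weight n.+1 = weight n * \prod_(j < d) ((n + d)%:R - j%:R).
Proof.
have -> : \prod_(j < d) ((n + d)%:R - j%:R) = \prod_(j < d) (n + j).+1%:R :> R.
  rewrite (reindex_inj rev_ord_inj) /=; apply: eq_bigr => j _.
  by rewrite -natrB; [congr _%:R | ]; have := ltn_ord j; lia.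
rewrite -big_split; apply: eq_bigr => i _ /=.
by rewrite addSn factS -natrM; congr _%:R; lia.
Qed.

(** Divided by its value at [origin], so that the factorials [i!] of that value
    need not be computed. *)
Definition family_formula n x : R :=
  weight n * (vdm x / vdm (origin d)) * \prod_i recip (n + d) (x i).

Lemma vdm_origin_neq0 : vdm (origin d) != 0.
Proof.
rewrite vdmE; apply/prodf_neq0 => i _; apply/prodf_neq0 => j ij.
by rewrite subr_eq0 !ffunE -!pmulrn eqr_nat gtn_eqF.
Qed.

Lemma family_formulaS n x : family_formula n.+1 x =
  \sum_(A : {set 'I_d}) family_formula n (x - indicator A).
Proof.
transitivity (\sum_(A : {set 'I_d}) weight n / vdm (origin d) *
    (vdm (x - indicator A) * \prod_i recip (n + d) ((x - indicator A) i))).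
  by rewrite -big_distrr /= vdm_recip_sum /family_formula weightS addSn; ring.
by apply: eq_bigr => A _; rewrite /family_formula; ring.
Qed.

Lemma vdm_eq0 x (i j : 'I_d) : i != j -> x i = x j -> vdm x = 0.
Proof.
by move=> ij e; apply: (determinant_alternate ij) => k; rewrite !mxE e.
Qed.

Lemma bin_factR n k : (k <= n)%N -> 'C(n, k)%:R = n`!%:R / (k`!%:R * (n - k)`!%:R) :> R.
Proof.
move=> kn; rewrite -(bin_fact kn) !natrM mulfK //.
by rewrite mulf_neq0 ?fact_neq0.
Qed.

Lemma vdm_translate x k : vdm (x + const_vec d k) = vdm x.
Proof.
rewrite !vdmE; do 2 (apply: eq_bigr => ? _).
by rewrite !addvE !const_vecE -!intrB; congr _%:~R; lia.
Qed.

Lemma family_formula_packed n k : (0 < d)%N ->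
  family_formula n (origin d + const_vec d k%:Z) = hoggatt_number R d n k.
Proof.
move=> d0; rewrite /family_formula /hoggatt_number vdm_translate divff ?vdm_origin_neq0 // mulr1.
have posE i : (origin d + const_vec d k%:Z) i = (i + k)%N%:Z.
  by rewrite addvE const_vecE ffunE PoszD.
have [nk|kn] := ltnP n k.
  have dm : (d.-1 < d)%N by rewrite prednK.
  rewrite [X in _ * X](bigD1 (Ordinal dm)) //= posE /= ltnNge.
  have -> : (n + d <= d.-1 + k)%N by lia.
  rewrite mul0r mulr0 (bigD1 (Ordinal d0)) //= addn0 bin_small //.
  by rewrite !mul0r.
have -> : \prod_i recip (n + d) ((origin d + const_vec d k%:Z) i) =
    \prod_(i < d) ((k + i)`! * (n - k + i)`!)%:R^-1.
  transitivity (\prod_(i < d) ((k + i)`!%:R^-1 : R) * \prod_(i < d) ((n - k + i)`!%:R^-1 : R)).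
    rewrite [X in _ * X](reindex_inj rev_ord_inj) -big_split /=; apply: eq_bigr => i _.
    rewrite posE /=; have id := ltn_ord i.
    have -> : (i + k < n + d)%N by lia.
    by rewrite natrM invfM; congr (_`!%:R^-1 * _`!%:R^-1); lia.
  by rewrite -big_split; apply: eq_bigr => i _; rewrite /= natrM invfM.
rewrite -big_split; apply: eq_bigr => i _ /=.
have e : (n + i - k = n - k + i)%N by rewrite addnBAC.
rewrite !bin_factR ?leq_addr ?(leq_trans kn) ?leq_addr // !natrM addKn e.
field; by rewrite !fact_neq0.
Qed.

Lemma family_formula0 x : (0 < d)%N -> strict x -> family_formula 0 x = (x == origin d)%:R.
Proof.
move=> d0 sx; have [->|nx] := eqVneq x (origin d).
  have e : origin d = origin d + const_vec d 0%N%:Z.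
    by apply/ffunP=> i; rewrite addvE const_vecE addr0.
  rewrite e family_formula_packed // /hoggatt_number big1 // => i _.
  by rewrite !bin0 divr1.
suff [i xi] : exists i, ~~ (0 <= x i < d%:Z).
  rewrite /family_formula (bigD1 i) //= (_ : recip _ _ = 0) ?mul0r ?mulr0 //.
  by move: xi; rewrite add0n; case: (x i) => // k /=; rewrite ltz_nat => /negPf ->.
apply/existsP; rewrite -negb_forall; apply: contra nx => /forallP h.
have w := strict_wider sx.
have lo : forall i : 'I_d, i%:Z <= x i.
  move=> i; have := w (Ordinal d0) i (leq0n i); have := h (Ordinal d0).
  by rewrite !ffunE /=; lia.
have dm : (d.-1 < d)%N by rewrite prednK.
apply/eqP/ffunP=> i; rewrite ffunE; apply/eqP; rewrite eq_le lo andbT.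
have id : (i <= d.-1)%N by have := ltn_ord i; lia.
have := w i (Ordinal dm) id; have := h (Ordinal dm).
by rewrite !ffunE /=; lia.
Qed.

(** The formula satisfies the recurrence of [families] without any condition on
    collisions, because the determinant vanishes when two particles meet. *)
Lemma families_formula n x : (0 < d)%N -> strict x ->
  (families (origin d) n x)%:R = family_formula n x.
Proof.
move=> d0; elim: n x => [|n IH] x sx; first by rewrite family_formula0.
rewrite family_formulaS [families _ _ _]/(step (families (origin d) n) x) /step sx mul1n advancesE natr_sum.
apply: eq_bigr => A _; have [|ns] := boolP (strict (x - indicator A)); first exact: IH.
have [/eqP -> |] := boolP (families (origin d) n (x - indicator A) == 0%N); last first.
  by move=> /families_strict; rewrite (negPf ns).
move: ns; rewrite negb_forall => /existsP[i]; rewrite negb_forall => /existsP[j].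
rewrite negb_imply => /andP[/eqP ij].
have := strictP _ sx i j ij; rewrite !subvE !ffunE => h1 h2.
have ne : i != j by apply/eqP => e; move: ij; rewrite e; lia.
rewrite /family_formula (@vdm_eq0 _ i j) ?mul0r ?mulr0 ?mul0r // !subvE !ffunE.
by move: h1 h2; case: (i \in A); case: (j \in A) => /=; lia.
Qed.

End Product.

Lemma coef_packed_pairs (R : numFieldType) (d n m t : nat) : (0 < d)%N ->
  (hoggatt_poly R d n * hoggatt_poly R d m)`_t = (packed_pairs d n m t)%:R.
Proof.
move=> d0.
have coefE n' k : (hoggatt_poly R d n')`_k = hoggatt_number R d n' k.
  rewrite /hoggatt_poly coef_sum.
  have [kn|nk] := ltnP k n'.+1.
    rewrite (bigD1 (Ordinal kn)) //= coefZ coefXn eqxx mulr1 big1 ?addr0 // => i ne.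
    by rewrite coefZ coefXn eq_sym -[k]/(val (Ordinal kn)) (inj_eq val_inj) (negPf ne) mulr0.
  rewrite big1 => [|i _]; last first.
    by rewrite coefZ coefXn gtn_eqF ?mulr0 // (leq_trans (ltn_ord i)).
  rewrite /hoggatt_number (bigD1 (Ordinal d0)) //= addn0 bin_small // mul0r mul0r //.
rewrite coefM /packed_pairs natr_sum; apply: eq_bigr => k _.
have hk : (k <= t)%N by rewrite -ltnS.
have -> : t%:Z - k%:Z = (t - k)%N%:Z by lia.
rewrite natrM !families_formula ?strict_translate ?strict_origin //.
by rewrite !family_formula_packed // !coefE.
Qed.

Theorem theorem1p2 (R : realType) (d : nat) (hd : (1 <= d)%N) :
  strongly_q_log_convex (hoggatt_poly R d).
Proof.
move=> n [//|m] /andP[_ mn]; apply/polyOverP => t.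
rewrite coefB !coef_packed_pairs // nnegrE subr_ge0 ler_nat.
exact: packed_pairs_le hd (ltnW mn).
Qed.
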